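(* Let $K\ge 2$, let $i\neq j$ be two classes in $\{1,\dots,K\}$, let $0.5\le \lambda_2<\lambda_1<1$, and set $\widetilde{\boldsymbol q}_a=\lambda_a \boldsymbol e_i+(1-\lambda_a)\boldsymbol e_j$ for $a=1,2$. For $\delta\ge 0$ let $(\boldsymbol p_1^{FL},\boldsymbol p_2^{FL})$ be an optimal solution of $$\min_{\boldsymbol p_1,\boldsymbol p_2\in\Delta^K}\ \mathcal L_{FL}(\boldsymbol p_1,\widetilde{\boldsymbol q}_1)+\mathcal L_{FL}(\boldsymbol p_2,\widetilde{\boldsymbol q}_2)\quad\text{subject to}\quad \|\boldsymbol p_1-\boldsymbol p_2\|_2^2\le\delta,$$ where $\mathcal L_{FL}$ is the Focal loss with parameter $\gamma_{FL}=1$, and let $\beta(\boldsymbol p_1,\boldsymbol p_2)=\|\boldsymbol p_1-\widetilde{\boldsymbol q}_1\|_2^2-\|\boldsymbol p_2-\widetilde{\boldsymbol q}_2\|_2^2$. Then for every $\delta$ with $0\le\delta<\|\widetilde{\boldsymbol q}_1-\widetilde{\boldsymbol q}_2\|_2^2$ we have $\beta(\boldsymbol p_1^{FL},\boldsymbol p_2^{FL})>0$.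
   Context: $\Delta^K=\{\boldsymbol p\in[0,1]^K:\sum_{k=1}^K p^k=1\}$ is the probability simplex and $\boldsymbol e_k$ is the $k$-th standard basis vector (one-hot label of class $k$). The Focal loss with parameter $\gamma$ is $\mathcal L_{FL}(\boldsymbol p,\boldsymbol q)=-\sum_{k=1}^K q^k(1-p^k)^{\gamma}\log p^k$ for $\boldsymbol p,\boldsymbol q\in\Delta^K$ (here $\gamma=1$), with terms having $q^k=0$ read as $0$ and the value being $+\infty$ if $p^k=0$ for some $k$ with $q^k>0$. *)

(* Defs.v *)
From HB Require Import structures.
From mathcomp Require Import all_boot all_order all_algebra.
From mathcomp Require Import all_classical all_reals all_analysis.

Set Implicit Arguments.
Unset Strict Implicit.
Unset Printing Implicit Defensive.

Import Order.TTheory GRing.Theory Num.Theory.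

Local Open Scope classical_set_scope.
Local Open Scope ring_scope.

(* Row vectors [p : 'rV[R]_K], with [p 0 k] for p^k; [delta_mx 0 k] is the
   k-th standard basis vector. *)

Definition simplex (R : realType) (K : nat) : set 'rV[R]_K :=
  [set p | (forall k, 0 <= p 0 k <= 1) /\ \sum_(k < K) p 0 k = 1].

(* MathComp-Analysis' [`|v|] is the sup norm on ['rV[R]_K], hence this. *)
Definition l2norm (R : realType) (K : nat) (v : 'rV[R]_K) : R :=
  Num.sqrt (\sum_(k < K) v 0 k ^+ 2).

(* [lne 0 = -oo] and [0 * -oo = 0] in [\bar R]: a term with [q 0 k = 0]
   vanishes, and the loss is [+oo] as soon as [p 0 k = 0 < q 0 k] for some k. *)
Definition focal_loss (R : realType) (K : nat) (gamma : R)
    (p q : 'rV[R]_K) : \bar R :=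
  (- \sum_(k < K)
      ((q 0 k)%:E * ((1 - p 0 k) `^ gamma)%:E * lne (p 0 k)%:E))%E.

Definition soft_label (R : realType) (K : nat) (i j : 'I_K) (lambda : R) :
    'rV[R]_K :=
  lambda *: delta_mx 0 i + (1 - lambda) *: delta_mx 0 j.

Definition feasible (R : realType) (K : nat) (delta : R)
    (p1 p2 : 'rV[R]_K) : Prop :=
  [/\ simplex p1, simplex p2 & l2norm (p1 - p2) ^+ 2 <= delta].

Definition fl_objective (R : realType) (K : nat) (gamma : R)
    (q1 q2 p1 p2 : 'rV[R]_K) : \bar R :=
  (focal_loss gamma p1 q1 + focal_loss gamma p2 q2)%E.

Definition fl_optimal (R : realType) (K : nat) (gamma delta : R)
    (q1 q2 p1 p2 : 'rV[R]_K) : Prop :=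
  feasible delta p1 p2 /\
  forall p1' p2' : 'rV[R]_K, feasible delta p1' p2' ->
    (fl_objective gamma q1 q2 p1 p2 <= fl_objective gamma q1 q2 p1' p2')%E.

Definition beta (R : realType) (K : nat) (q1 q2 p1 p2 : 'rV[R]_K) : R :=
  l2norm (p1 - q1) ^+ 2 - l2norm (p2 - q2) ^+ 2.

(* Main.v *)
(* On the edge [p = x e_i + (1 - x) e_j] the difference of squared distances is
   beta = 2 (x1 - x2 - (l1 - l2)) (x1 + x2 - (l1 + l2)).  Projecting on the
   edge is nonexpansive and lowers the loss, so optima lie on it, and the constraint
   makes the first factor negative; it remains to see that x1 + x2 < l1 + l2.
   Otherwise the derivative of the objective in the direction (1, 1), which
   preserves x1 - x2, is positive, and shifting both points down improves it.
   By convexity, positivity need only be checked when x1 + x2 = l1 + l2, where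
   ln x <= x - 1 is enough. *)

Require Import Defs.
From HB Require Import structures.
From mathcomp Require Import all_boot all_order all_algebra.
From mathcomp Require Import all_classical all_reals all_analysis.
From mathcomp Require Import ring lra.
Import Order.TTheory GRing.Theory Num.Theory.
Import numFieldNormedType.Exports.
Local Open Scope classical_set_scope.
Local Open Scope ring_scope.

(** * Logarithm bounds and convexity of the loss on the edge *)

Lemma ln_leB1 (R : realType) (x : R) : 0 < x -> ln x <= x - 1.
Proof. by move=> x0; rewrite -{1}(subrKC 1 x) le_ln1Dx//; lra. Qed.

Lemma lnB_le (R : realType) (x y : R) :
  0 < x -> 0 < y -> ln x - ln y <= x / y - 1.
Proof. by move=> x0 y0; rewrite -ln_div ?posrE// ln_leB1// divr_gt0. Qed.

Definition focal (R : realType) (x : R) : R := - ((1 - x) * ln x).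

(* This is [- focal^`()]. *)
Definition focal_slope (R : realType) (x : R) : R := x^-1 - 1 - ln x.

Definition face_loss (R : realType) (l x : R) : R :=
  l * focal R x + (1 - l) * focal R (1 - x).

(** The derivative of [face_loss R l]; the terms have opposite signs because the second [focal] is
    evaluated at [1 - x]. *)
Definition face_slope (R : realType) (l x : R) : R :=
  (1 - l) * focal_slope R (1 - x) - l * focal_slope R x.

(** Convexity without derivatives: the right side minus the left is exactly [(x - y) ^+ 2 / y] plus
    [(1 - x) * ((x / y - 1) - (ln x - ln y))], both nonnegative. *)
Lemma focal_tangent (R : realType) (x y : R) : 0 < x <= 1 -> 0 < y ->
  focal R y - focal_slope R y * (x - y) <= focal R x.
Proof.
move=> /andP[x0 x1] y0; have := lnB_le _ _ _ x0 y0; rewrite /focal /focal_slope.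
move=> H.
have : 0 <= (x - y) ^+ 2 / y by rewrite divr_ge0 ?sqr_ge0// ltW.
have -> : (x - y) ^+ 2 / y = (x / y - 1) * (x - 1) + (x-y)*(y^-1 - 1).
  by field; lra.
have : 0 <= (1 - x) * ((x / y - 1) - (ln x - ln y)).
  by rewrite mulr_ge0//; lra.
lra.
Qed.

Lemma face_loss_tangent (R : realType) (l x y : R) :
  0 <= l <= 1 -> 0 < x < 1 -> 0 < y < 1 ->
  face_loss R l y + face_slope R l y * (x - y) <= face_loss R l x.
Proof.
move=> /andP[l0 l1] /andP[x0 x1] /andP[y0 y1].
have H1 : focal R y - focal_slope R y * (x - y) <= focal R x.
  by apply: focal_tangent => //; lra.
have H2 : focal R (1 - y) - focal_slope R (1 - y) * ((1 - x) - (1 - y))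
    <= focal R (1 - x) by apply: focal_tangent; lra.
rewrite /face_loss /face_slope.
have : l * (focal R y - focal_slope R y * (x - y)) <= l * focal R x.
  by rewrite ler_wpM2l.
have : (1 - l) * (focal R (1 - y) - focal_slope R (1 - y) * ((1 - x) - (1 - y)))
   <= (1 - l) * focal R (1 - x) by rewrite ler_wpM2l//; lra.
lra.
Qed.

Lemma focal_slope_le (R : realType) (x y : R) :
  0 < x -> x <= y -> focal_slope R y <= focal_slope R x.
Proof.
move=> x0 xy; have y0 : 0 < y by lra.
rewrite /focal_slope.
have : ln x <= ln y by rewrite ler_ln ?posrE.
have : y^-1 <= x^-1 by rewrite lef_pV2 ?posrE.
lra.
Qed.

Lemma face_slope_le (R : realType) (l x y : R) : 0 <= l <= 1 ->
  0 < x -> x <= y -> y < 1 -> face_slope R l x <= face_slope R l y.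
Proof.
move=> /andP[l0 l1] x0 xy y1; rewrite /face_slope.
have H1 : focal_slope R y <= focal_slope R x by exact: focal_slope_le.
have H2 : focal_slope R (1 - x) <= focal_slope R (1 - y).
  by apply: focal_slope_le; lra.
by rewrite lerB// ler_wpM2l//; lra.
Qed.

(** * Positivity of the sum of the two slopes *)

Definition slope_sum (R : realType) (x : R) : R :=
  focal_slope R x + focal_slope R (1 - x).

(** The slope is affine in [l], with coefficient [- slope_sum]; it is expanded here at the matched
    label [l = x]. *)
Lemma face_slope_affine (R : realType) (l x : R) :
  face_slope R l x = face_slope R x x - (l - x) * slope_sum R x.
Proof. by rewrite /face_slope /slope_sum; ring. Qed.

(** Only [v = x * (1 - x)] matters, and [v^-1 - 2 - ln v] decreases in [v], so bounds on [v] give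
    bounds on [slope_sum]. *)
Lemma slope_sumE (R : realType) (x : R) : 0 < x < 1 ->
  slope_sum R x = (x * (1 - x))^-1 - 2 - ln (x * (1 - x)).
Proof.
move=> /andP[x0 x1]; rewrite /slope_sum /focal_slope lnM ?posrE//; last lra.
by field; lra.
Qed.

(** As [v = x * (1 - x) <= 1 / 4], one has [v^-1 >= 4] and [- ln v >= 1 - v >= 3 / 4]; the constant
    is [4 - 2 + 3 / 4]. *)
Lemma slope_sum_ge (R : realType) (x : R) :
  0 < x < 1 -> 11 / 4 <= slope_sum R x.
Proof.
move=> x01; rewrite slope_sumE//.
have v0 : 0 < x * (1 - x) by rewrite mulr_gt0//; lra.
have v4 : x * (1 - x) <= 1 / 4 by have := sqr_ge0 (x - 1 / 2); lra.
have := ln_leB1 _ _ v0.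
have : 4 <= (x * (1 - x))^-1 by rewrite -[4]invrK lef_pV2 ?posrE//; lra.
lra.
Qed.

Lemma slope_sum_le (R : realType) (x y : R) : 1 / 2 <= y -> y <= x -> x < 1 ->
  slope_sum R y <= slope_sum R x.
Proof.
move=> y2 yx x1; rewrite !slope_sumE; try lra.
have v0 : 0 < x * (1 - x) by rewrite mulr_gt0//; lra.
have w0 : 0 < y * (1 - y) by rewrite mulr_gt0//; lra.
have vw : x * (1 - x) <= y * (1 - y) by nra.
have : ln (x * (1 - x)) <= ln (y * (1 - y)) by rewrite ler_ln ?posrE.
have : (y * (1 - y))^-1 <= (x * (1 - x))^-1 by rewrite lef_pV2 ?posrE.
lra.
Qed.

(** The reciprocals contribute at most [16 / 3 - 4 = 4 / 3], the logarithms at most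
    [w / v - 1 <= 1 / 3]. *)
Lemma slope_sumB_le (R : realType) (x y : R) :
  1 / 2 <= y -> y <= x -> x <= 3 / 4 ->
  slope_sum R x - slope_sum R y <= 5 / 3.
Proof.
move=> y2 yx x1; rewrite !slope_sumE; try lra.
have v0 : 3 / 16 <= x * (1 - x) by nra.
have w4 : y * (1 - y) <= 1 / 4 by have := sqr_ge0 (y - 1 / 2); lra.
have w0 : 0 < y * (1 - y) by rewrite mulr_gt0//; lra.
move: v0 w4 w0; set v := x * _; set w := y * _ => v0 w4 w0.
have := lnB_le _ w v w0 ltac:(lra).
have : 4 <= w^-1 by rewrite -[4]invrK lef_pV2 ?posrE//; lra.
have v3 : v^-1 <= 16 / 3 by rewrite -[16 / 3]invrK lef_pV2 ?posrE//; lra.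
have : w / v <= 4 / 3.
  by rewrite ler_pdivrMr; lra.
lra.
Qed.

(** Even at the label itself the slope is positive above [1 / 2]: the focal loss pulls predictions
    back towards [1 / 2]. *)
Lemma face_slope_diag_ge (R : realType) (x : R) : 1 / 2 <= x < 1 ->
  (2 * x - 1) * (3 / 2 - x) <= face_slope R x x.
Proof.
move=> /andP[x2 x1].
have -> : face_slope R x x = 2 * x - 1 + x * ln x - (1 - x) * ln (1 - x).
  by rewrite /face_slope /focal_slope; field; lra.
(* Both logarithms are expanded at [1/2], where the slope vanishes. *)
have H1 : ln (1 / 2) - ln x <= 1 / 2 / x - 1 by apply: lnB_le; lra.
have H2 : ln (1 - x) - ln (1 / 2) <= (1 - x) / (1 / 2) - 1.
  by apply: lnB_le; lra.
(* The bound [ln 2 <= 1] absorbs the term [(2 * x - 1) * ln 2] left by the two expansions. *)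
have H3 : ln 2 - ln 1 <= 2 / 1 - 1 :> R by apply: lnB_le; lra.
have L : ln (1 / 2) = - ln 2 :> R by rewrite div1r lnV ?posrE//; lra.
rewrite ln1 in H3; rewrite L in H1 H2.
have : x * (- ln 2 - ln x) <= 1 / 2 - x.
  have -> : 1 / 2 - x = x * (1 / 2 / x - 1) by field; lra.
  by rewrite ler_wpM2l//; lra.
have : (1 - x) * (ln (1 - x) - - ln 2) <= (1 - x) * ((1 - x) / (1 / 2) - 1).
  by rewrite ler_wpM2l//; lra.
have : (2 * x - 1) * ln 2 <= (2 * x - 1) * 1 by rewrite ler_wpM2l//; lra.
lra.
Qed.

(** With [e = l1 - x1 = x2 - l2], the sum is the two diagonal slopes minus
    [e * (slope_sum R x1 - slope_sum R x2)]. The hypotheses give [0 < e < l1 - l2], so both points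
    lie in [(1/2, 1)], and the last term can hurt only if [x2 < x1]. *)
Lemma face_slope_add_gt0_balanced (R : realType) (l1 l2 x1 x2 : R) :
  1 / 2 <= l2 -> l2 < l1 -> l1 < 1 ->
  x1 + x2 = l1 + l2 -> `|x1 - x2| < l1 - l2 ->
  0 < face_slope R l1 x1 + face_slope R l2 x2.
Proof.
move=> hl2 hl21 hl1 hx; rewrite ltr_norml => /andP[d1 d2].
pose e := l1 - x1.
have e0 : 0 < e by rewrite /e; lra.
have [x1l x2l] : x1 = l1 - e /\ x2 = l2 + e by rewrite /e; split; lra.
rewrite (face_slope_affine _ l1) (face_slope_affine _ l2).
have -> : l1 - x1 = e by [].
have -> : l2 - x2 = - e by lra.
have P1 := face_slope_diag_ge R x1 ltac:(lra).
have P2 := face_slope_diag_ge R x2 ltac:(lra).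
have p2 : 0 <= face_slope R x2 x2 by nra.
have [x12|x21] := leP x1 x2.
  have : slope_sum R x1 <= slope_sum R x2 by apply: slope_sum_le; lra.
  by nra.
have S12 : slope_sum R x2 <= slope_sum R x1 by apply: slope_sum_le; lra.
have [x34|x34] := leP x1 (3 / 4).
  (* Since [l2 >= 1 / 2], [e <= x2 - 1 / 2], so the loss is at most [5 / 6 * (2 * x2 - 1)]; below
     [3 / 4] the diagonal slopes give at least [3 / 2 * (2 * x2 - 1)]. *)
  have := slope_sumB_le R x1 x2 ltac:(lra) ltac:(lra) x34.
  by nra.
(* Raising [e] to [1 - x1] only helps; the first slope then becomes
   [- focal_slope x1]. *)
have : e * (slope_sum R x1 - slope_sum R x2) <=
    (1 - x1) * (slope_sum R x1 - slope_sum R x2) by rewrite ler_wpM2r//; lra.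
have : face_slope R x1 x1 - (1 - x1) * slope_sum R x1 = - focal_slope R x1.
  by rewrite /face_slope /slope_sum; ring.
(* Both [x1^-1 - 1] and [- ln x1] are at most [4 / 3 * (1 - x1)] because [x1 > 3 / 4]; their total
   [8 / 3] stays below the [11 / 4] of [slope_sum_ge]. *)
have : focal_slope R x1 <= 8 / 3 * (1 - x1).
  rewrite /focal_slope.
  have := lnB_le _ 1 x1 ltac:(lra) ltac:(lra); rewrite ln1 div1r.
  have : x1^-1 - 1 <= 4 / 3 * (1 - x1).
    rewrite -(ler_pM2r (_ : 0 < x1)); last lra.
    by rewrite mulrBl mulVf; nra.
  lra.
have := slope_sum_ge R x2 ltac:(lra).
by nra.
Qed.

Lemma face_slope_add_gt0 (R : realType) (l1 l2 x1 x2 : R) :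
  1 / 2 <= l2 -> l2 < l1 -> l1 < 1 -> x1 < 1 -> x2 < 1 ->
  l1 + l2 <= x1 + x2 -> `|x1 - x2| < l1 - l2 ->
  0 < face_slope R l1 x1 + face_slope R l2 x2.
Proof.
move=> hl2 hl21 hl1 hx1 hx2 hx /[dup] hd; rewrite ltr_norml => /andP[d1 d2].
(* Half the excess: subtracting [s] from both points restores the sum [l1 + l2] and keeps their
   difference. *)
pose s := (x1 + x2 - l1 - l2) / 2.
have : 0 < face_slope R l1 (x1 - s) + face_slope R l2 (x2 - s).
  apply: face_slope_add_gt0_balanced => //; first by rewrite /s; lra.
  by have -> : x1 - s - (x2 - s) = x1 - x2 by ring.
have : face_slope R l1 (x1 - s) <= face_slope R l1 x1.
  by apply: face_slope_le; rewrite /s; lra.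
have : face_slope R l2 (x2 - s) <= face_slope R l2 x2.
  by apply: face_slope_le; rewrite /s; lra.
lra.
Qed.

(** * Strict decrease under a small common shift *)

Lemma focal_slope_continuous (R : realType) (x : R) :
  0 < x -> {for x, continuous (focal_slope R)}.
Proof.
move=> x0; rewrite /focal_slope.
apply: cvgB; last exact: continuous_ln.
by apply: cvgB; [apply: cvgV; [lra|exact: cvg_id]|exact: cvg_cst].
Qed.

Lemma face_slope_continuous (R : realType) (l x : R) :
  0 < x < 1 -> {for x, continuous (face_slope R l)}.
Proof.
move=> /andP[x0 x1]; rewrite /face_slope.
apply: cvgB; (apply: cvgM; first exact: cvg_cst).
  apply: (@cvg_comp _ _ _ (fun y => 1 - y) (focal_slope R) _ (nbhs (1 - x))).
    by apply: cvgB; [exact: cvg_cst|exact: cvg_id].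
  by apply: focal_slope_continuous; lra.
exact: focal_slope_continuous.
Qed.

(** The tangents are taken at the shifted points, where continuity keeps the summed slope positive
    for small [s > 0]; the decrease is then at least [s] times that slope. *)
Lemma face_loss_descent (R : realType) (l1 l2 x1 x2 : R) :
  0 <= l1 <= 1 -> 0 <= l2 <= 1 -> 0 < x1 < 1 -> 0 < x2 < 1 ->
  0 < face_slope R l1 x1 + face_slope R l2 x2 ->
  exists s, [/\ 0 < x1 - s < 1, 0 < x2 - s < 1 &
    face_loss R l1 (x1 - s) + face_loss R l2 (x2 - s) <
    face_loss R l1 x1 + face_loss R l2 x2].
Proof.
move=> hl1 hl2 hx1 hx2 hs.
have cont (l x : R) : 0 < x < 1 ->
    face_slope R l (x - s) @[s --> 0^'+] --> face_slope R l x.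
  move=> hx; apply: cvg_at_right_filter.
  apply: (@cvg_comp _ _ _ (fun s => x - s) (face_slope R l) _ (nbhs x)).
    have : (x - s) @[s --> (0 : R)] --> x - 0.
      by apply: cvgB; [exact: cvg_cst|exact: cvg_id].
    by rewrite subr0.
  exact: face_slope_continuous.
have pos : \forall s \near (0 : R)^'+,
    0 < face_slope R l1 (x1 - s) + face_slope R l2 (x2 - s).
  by apply: (cvgr_gt _ (cvgD (cont l1 x1 hx1) (cont l2 x2 hx2))).
have n1 : \forall s \near (0 : R)^'+, s < x1 by apply: nbhs_right_lt; lra.
have n2 : \forall s \near (0 : R)^'+, s < x2 by apply: nbhs_right_lt; lra.
have n0 : \forall s \near (0 : R)^'+, 0 < s by exact: nbhs_right_gt.
have [s [s0 [sx1 [sx2 sp]]]] :=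
  filter_ex (filterI n0 (filterI n1 (filterI n2 pos))).
exists s; split; [lra|lra|].
have H1 := face_loss_tangent R l1 x1 (x1 - s) hl1 hx1 ltac:(lra).
have H2 := face_loss_tangent R l2 x2 (x2 - s) hl2 hx2 ltac:(lra).
have := mulr_gt0 s0 sp.
lra.
Qed.

(** * Monotonicity, sums and norms for the reduction to the edge *)

Lemma focal_lt (R : realType) (x y : R) :
  0 < x -> x < y -> y <= 1 -> focal R y < focal R x.
Proof.
move=> x0 xy y1; rewrite /focal ltrN2.
have lx : ln x < ln y by rewrite ltr_ln ?posrE//; lra.
have ly : ln y <= 0 by exact: ln_le0.
nra.
Qed.

Lemma sum_two (V : nmodType) (K : nat) (i j : 'I_K) (F : 'I_K -> V) :
  i != j -> (forall k, k != i -> k != j -> F k = 0) ->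
  \sum_(k < K) F k = F i + F j.
Proof.
move=> ij F0; rewrite (bigD1 i)//= (bigD1 j) 1?eq_sym//= big1 ?addr0//.
by move=> k /andP[ki kj]; exact: F0.
Qed.

Lemma sum_two_le (R : numDomainType) (K : nat) (i j : 'I_K) (F : 'I_K -> R) :
  i != j -> (forall k, 0 <= F k) -> F i + F j <= \sum_(k < K) F k.
Proof.
move=> ij F0; rewrite [leRHS](bigD1 i)//= (bigD1 j) 1?eq_sym//=.
by rewrite addrA lerDl sumr_ge0.
Qed.

Lemma l2norm_sqr (R : realType) (K : nat) (v : 'rV[R]_K) :
  l2norm v ^+ 2 = \sum_(k < K) v 0 k ^+ 2.
Proof. by rewrite sqr_sqrtr// sumr_ge0// => k _; exact: sqr_ge0. Qed.

(** * The edge of the simplex, and why optima lie on it *)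

Section face.
Context (R : realType) (K : nat) (i j : 'I_K) (ij : i != j).
Implicit Types (p q : 'rV[R]_K) (l x y delta : R).

Lemma soft_label_l x : soft_label i j x 0 i = x.
Proof. by rewrite !mxE !eqxx (negPf ij) /=; ring. Qed.

Lemma soft_label_r x : soft_label i j x 0 j = 1 - x.
Proof. by rewrite !mxE !eqxx eq_sym (negPf ij) /=; ring. Qed.

Lemma soft_label_other x k : k != i -> k != j -> soft_label i j x 0 k = 0.
Proof. by move=> /negPf ki /negPf kj; rewrite !mxE eqxx ki kj /=; ring. Qed.

Lemma l2norm_soft_label x y :
  l2norm (soft_label i j x - soft_label i j y) ^+ 2 = 2 * (x - y) ^+ 2.
Proof.
have E k : (soft_label i j x - soft_label i j y) 0 k =
    soft_label i j x 0 k - soft_label i j y 0 k by rewrite !mxE.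
rewrite l2norm_sqr (sum_two _ _ i j)// => [|k ki kj].
  by rewrite !E !soft_label_l !soft_label_r; ring.
by rewrite E !soft_label_other// subr0 expr0n.
Qed.

Lemma simplex_soft_label x : 0 <= x <= 1 -> simplex (soft_label i j x).
Proof.
move=> x01; split=> [k|].
  have [->|ki] := eqVneq k i; first by rewrite soft_label_l.
  have [->|kj] := eqVneq k j; first by rewrite soft_label_r; lra.
  by rewrite soft_label_other// lexx ler01.
rewrite (sum_two _ _ i j)// => [|k ki kj]; last exact: soft_label_other.
by rewrite soft_label_l soft_label_r subrKC.
Qed.

Lemma simplex_face_le1 p : simplex p -> p 0 i + p 0 j <= 1.
Proof.
by move=> [p01 <-]; apply: sum_two_le => // k; have /andP[] := p01 k.
Qed.

Lemma simplex_face p : simplex p -> p 0 i + p 0 j = 1 ->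
  p = soft_label i j (p 0 i).
Proof.
move=> [p01 p1] pij; apply/rowP => k.
have [->|ki] := eqVneq k i; first by rewrite soft_label_l.
have [->|kj] := eqVneq k j; first by rewrite soft_label_r -pij; ring.
rewrite soft_label_other//.
move: p1; rewrite (bigD1 i)//= (bigD1 j) 1?eq_sym//= addrA pij => p1.
have /psumr_eq0P : \sum_(k0 < K | (k0 != i) && (k0 != j)) p 0 k0 = 0 by lra.
by apply; [move=> m _; have /andP[] := p01 m|rewrite ki kj].
Qed.

Lemma focal_lossE l p : simplex p ->
  focal_loss 1 p (soft_label i j l) =
  (- (l%:E * (1 - p 0 i)%:E * lne (p 0 i)%:E +
      (1 - l)%:E * (1 - p 0 j)%:E * lne (p 0 j)%:E))%E.
Proof.
move=> [p01 _]; rewrite /focal_loss (sum_two _ _ i j)// => [|k ki kj].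
  by rewrite soft_label_l soft_label_r !powRr1// subr_ge0;
    [have /andP[] := p01 j|have /andP[] := p01 i].
by rewrite soft_label_other// !mul0e.
Qed.

Lemma focal_loss_fin l p : simplex p -> 0 < p 0 i -> 0 < p 0 j ->
  focal_loss 1 p (soft_label i j l) =
  (l * focal R (p 0 i) + (1 - l) * focal R (p 0 j))%:E.
Proof.
move=> sp pi0 pj0; rewrite focal_lossE// !lne_EFin//=.
by congr EFin; rewrite /focal; ring.
Qed.

Lemma focal_loss_soft_label l x : 0 < x < 1 ->
  focal_loss 1 (soft_label i j x) (soft_label i j l) = (face_loss R l x)%:E.
Proof.
move=> /andP[x0 x1]; rewrite focal_loss_fin ?soft_label_l ?soft_label_r//.
  by apply: simplex_soft_label; lra.
lra.
Qed.

(** At a zero coordinate the factor [1 - p] equals 1 and the label weight is positive, so that term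
    is [-oo], which absorbs the other summand. *)
Lemma focal_loss_pinfty l p : 0 < l < 1 -> simplex p ->
  ~ (0 < p 0 i /\ 0 < p 0 j) -> focal_loss 1 p (soft_label i j l) = +oo%E.
Proof.
move=> /andP[l0 l1] sp pij; rewrite focal_lossE//.
have [p01 _] := sp; have /andP[pi0 _] := p01 i; have /andP[pj0 _] := p01 j.
move: pi0; rewrite le_eqVlt => /orP[/eqP <-|pi0].
  by rewrite subr0 mule1 le0_lneNy// gt0_muleNy ?lte_fin// addNye.
move: pj0; rewrite le_eqVlt => /orP[/eqP <-|pj0]; last by case: pij.
by rewrite subr0 mule1 [lne 0]le0_lneNy// gt0_muleNy ?addeNy//
  lte_fin subr_gt0.
Qed.

(* Orthogonal projection onto the line through [delta_mx 0 i] and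
   [delta_mx 0 j]. *)
Definition face_proj p : R := (1 + p 0 i - p 0 j) / 2.

(** With [u], [v] the differences at [i] and [j], this is [(u - v)^2 / 2 <= u^2 + v^2]; other
    coordinates only enlarge the right side. *)
Lemma l2norm_face_proj_le p q :
  l2norm (soft_label i j (face_proj p) - soft_label i j (face_proj q)) ^+ 2 <=
  l2norm (p - q) ^+ 2.
Proof.
rewrite l2norm_soft_label l2norm_sqr.
apply: le_trans (sum_two_le _ _ i j _ ij (fun k => sqr_ge0 _)).
rewrite !mxE /face_proj.
have := sqr_ge0 ((p 0 i - q 0 i) + (p 0 j - q 0 j)).
lra.
Qed.

(** Projection gives half of the mass missing from [i] and [j] to each of them, and [focal] is
    strictly decreasing. The weak inequality is kept too, so that strictness at either point alone
    contradicts optimality of the pair. *)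
Lemma focal_loss_face_proj l p : 0 < l < 1 -> simplex p ->
  0 < p 0 i -> 0 < p 0 j ->
  0 < face_proj p < 1 /\
  exists2 a, focal_loss 1 p (soft_label i j l) = a%:E &
    (p 0 i + p 0 j = 1 \/ face_loss R l (face_proj p) < a) /\
    face_loss R l (face_proj p) <= a.
Proof.
move=> /andP[l0 l1] sp pi0 pj0; have s1 := simplex_face_le1 _ sp.
split; first by rewrite /face_proj; lra.
eexists; first exact: focal_loss_fin.
move: s1; rewrite le_eqVlt => /orP[/eqP s1|s1].
  have pE : face_proj p = p 0 i by rewrite /face_proj; lra.
  have jE : p 0 j = 1 - p 0 i by lra.
  by rewrite pE jE; split=> //; left; lra.
have H1 : focal R (face_proj p) < focal R (p 0 i).
  by apply: focal_lt; rewrite /face_proj; lra.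
have H2 : focal R (1 - face_proj p) < focal R (p 0 j).
  by apply: focal_lt; rewrite /face_proj; lra.
suff H : face_loss R l (face_proj p) <
    l * focal R (p 0 i) + (1 - l) * focal R (p 0 j).
  by split; [right|exact: ltW].
by rewrite /face_loss ltrD// ltr_pM2l// subr_gt0.
Qed.

Lemma fl_optimal_face l1 l2 delta p1 p2 : 0 < l1 < 1 -> 0 < l2 < 1 ->
  0 <= delta ->
  fl_optimal 1 delta (soft_label i j l1) (soft_label i j l2) p1 p2 ->
  exists x1 x2, [/\ 0 < x1 < 1, 0 < x2 < 1,
    p1 = soft_label i j x1 & p2 = soft_label i j x2].
Proof.
move=> hl1 hl2 d0 [[sp1 sp2 hd] opt].
have sh : simplex (soft_label i j (1 / 2 : R)).
  by apply: simplex_soft_label; lra.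
(* The pair of midpoints is feasible for every [delta >= 0] and has finite loss. *)
have fin : (fl_objective 1 (soft_label i j l1) (soft_label i j l2) p1 p2
    < +oo)%E.
  apply: le_lt_trans (opt (soft_label i j (1 / 2)) (soft_label i j (1 / 2)) _) _.
    by split=> //; rewrite l2norm_soft_label subrr expr0n mulr0.
  by rewrite /fl_objective !focal_loss_soft_label -?EFinD ?ltry//; lra.
have pos1 : 0 < p1 0 i /\ 0 < p1 0 j.
  apply: contrapT => n1; move: fin.
  rewrite /fl_objective focal_loss_pinfty//.
  (* A sum with [+oo] is [+oo] only if the other loss is not [-oo]; that loss is either finite or
     [+oo]. *)
  have [[pi0 pj0]|n2] := pselect (0 < p2 0 i /\ 0 < p2 0 j).
    by rewrite focal_loss_fin// addye.
  by rewrite focal_loss_pinfty.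
have pos2 : 0 < p2 0 i /\ 0 < p2 0 j.
  apply: contrapT => n2; move: fin; case: pos1 => pi0 pj0.
  by rewrite /fl_objective [X in (_ + X)%E]focal_loss_pinfty// focal_loss_fin.
have [y1 [a1 E1 [c1 le1]]] := focal_loss_face_proj _ _ hl1 sp1 pos1.1 pos1.2.
have [y2 [a2 E2 [c2 le2]]] := focal_loss_face_proj _ _ hl2 sp2 pos2.1 pos2.2.
have := opt (soft_label i j (face_proj p1)) (soft_label i j (face_proj p2)).
rewrite /fl_objective E1 E2 !focal_loss_soft_label// -!EFinD lee_fin => le12.
have {}le12 : a1 + a2 <= face_loss R l1 (face_proj p1) +
    face_loss R l2 (face_proj p2).
  apply: le12; split; [apply: simplex_soft_label; lra..|].
  exact: le_trans (l2norm_face_proj_le _ _) hd.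
have e1 : p1 0 i + p1 0 j = 1 by case: c1 => //; lra.
have e2 : p2 0 i + p2 0 j = 1 by case: c2 => //; lra.
exists (p1 0 i), (p2 0 i); split; [lra|lra|exact: simplex_face..].
Qed.

End face.

Theorem proposition3p3 (R : realType) (K : nat) (hK : (2 <= K)%N)
  (i j : 'I_K) (hij : i <> j) (lambda1 lambda2 : R)
  (hlambda2 : 1 / 2 <= lambda2) (hlambda21 : lambda2 < lambda1)
  (hlambda1 : lambda1 < 1) (delta : R) (hdelta0 : 0 <= delta)
  (hdelta : delta <
     l2norm (soft_label i j lambda1 - soft_label i j lambda2) ^+ 2)
  (p1 p2 : 'rV[R]_K)
  (hopt : fl_optimal 1 delta
     (soft_label i j lambda1) (soft_label i j lambda2) p1 p2) :
  0 < beta (soft_label i j lambda1) (soft_label i j lambda2) p1 p2.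
Proof.
have ij : i != j by exact/eqP.
have l1_01 : 0 < lambda1 < 1 by lra.
have l2_01 : 0 < lambda2 < 1 by lra.
have [x1 [x2 [x1_01 x2_01 p1E p2E]]] :=
  fl_optimal_face _ _ _ _ ij _ _ _ _ _ l1_01 l2_01 hdelta0 hopt.
case: hopt; rewrite p1E p2E {p1 p2 p1E p2E} => -[_ _ hd] opt.
have dist : `|x1 - x2| < lambda1 - lambda2.
  have := le_lt_trans hd hdelta; rewrite !l2norm_soft_label// ltr_pM2l//.
  by rewrite -real_normK ?num_real// ltr_pXn2r// nnegrE; lra.
have dist' : x1 - x2 < lambda1 - lambda2.
  exact: le_lt_trans (ler_norm _) dist.
have sum_lt : x1 + x2 < lambda1 + lambda2.
  rewrite ltNge; apply/negP => sum_ge.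
  have slope : 0 < face_slope R lambda1 x1 + face_slope R lambda2 x2.
    by apply: face_slope_add_gt0 => //; lra.
  have [s [s1 s2]] := face_loss_descent R lambda1 lambda2 x1 x2
    ltac:(lra) ltac:(lra) x1_01 x2_01 slope.
  rewrite ltNge => /negP; apply.
  (* The common shift leaves the distance unchanged, so the better pair is still feasible. *)
  have := opt (soft_label i j (x1 - s)) (soft_label i j (x2 - s)).
  rewrite /fl_objective !focal_loss_soft_label// -!EFinD lee_fin; apply.
  split; [apply: simplex_soft_label => //; lra..|].
  move: hd; rewrite !l2norm_soft_label//.
  by have -> : x1 - s - (x2 - s) = x1 - x2 by ring.
rewrite /beta !l2norm_soft_label//.
(* The product of the negative factors given by [dist'] and [sum_lt]. *)
by nra.
Qed.
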